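(* Let $N\ge2$ and $q\in(0,1]$ be fixed. Consider any policy $\pi$ such that $\mathbb{E}[Gap^\pi(T)]\in\mathcal{O}(1)$ as $T\to\infty$. Then $\mathbb{E}[M^\pi]\in\Omega(\sqrt T)$.
   Context: Balls-into-bins model: $T$ balls are sequentially allocated into $N\ge 2$ initially empty bins. In each period $t\in\{1,\dots,T\}$ a ball arrives; it has a preferred bin $P(t)$ drawn uniformly at random from $\{1,\dots,N\}$, and it is flexible ($f(t)=1$) with probability $q\in(0,1]$, otherwise $f(t)=0$. All draws are independent across periods and of each other. A policy $\pi$ (which may depend on $T$) is a non-anticipating rule determining $\omega^\pi(t)\in\{0,1\}$ (whether to exert flexibility in period $t$) from the numbers of balls in the bins. If $f(t)\omega^\pi(t)=1$, a flex set $\mathcal F(t)$ of two distinct bins is drawn uniformly at random and the ball is put in the bin of $\mathcal F(t)$ with the smaller current load (ties broken in favour of the smallest index). If $f(t)\omega^\pi(t)=0$ the ball is put in $P(t)$. Let $x_i^\pi(t)$ be the load of bin $i$ at the end of period $t$, $x_i^\pi(0)=0$, $Gap^\pi(t)=\max_{i}x_i^\pi(t)-t/N$, and $M^\pi=\sum_{t=1}^T f(t)\omega^\pi(t)$ the number of flex throws. *)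

(* Defs.v *)
From HB Require Import structures.
From mathcomp Require Import all_boot all_order all_algebra.
From mathcomp Require Import all_classical all_reals all_analysis.

Set Implicit Arguments.
Unset Strict Implicit.
Unset Printing Implicit Defensive.

Import Order.TTheory GRing.Theory Num.Theory.
Import numFieldNormedType.Exports.

Local Open Scope ring_scope.

(** A set of two distinct bins, encoded as the pair of its elements in
    increasing order. *)
Definition flexset (N : nat) : finType :=
  {b : 'I_N * 'I_N | (b.1 < b.2)%N}.

(** The randomness of one period: preferred bin, flexibility of the ball, flex
    set.  The flex set is drawn in every period, but it is only looked at when
    flexibility is exerted on a flexible ball. *)
Definition draw (N : nat) : finType := ('I_N * bool * flexset N)%type.

Definition preferred (N : nat) (d : draw N) : 'I_N := d.1.1.
Definition flexible (N : nat) (d : draw N) : bool := d.1.2.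
Definition flex_pair (N : nat) (d : draw N) : 'I_N * 'I_N := val d.2.

(** Under the law of one draw the three components are independent, the
    preferred bin and the flex set are uniform, and the ball is flexible with
    probability [q]. *)
Definition draw_prob (R : realType) (N : nat) (q : R) (d : draw N) : R :=
  N%:R^-1 * (if flexible d then q else 1 - q) * #|flexset N|%:R^-1.

(** Expectation of a function of [T] independent draws. *)
Definition expect (R : realType) (N : nat) (q : R) (T : nat)
    (X : T.-tuple (draw N) -> R) : R :=
  \sum_(s : T.-tuple (draw N)) (\prod_(t < T) draw_prob q (tnth s t)) * X s.

Definition loads (N : nat) : Type := {ffun 'I_N -> nat}.

Definition no_balls (N : nat) : loads N := [ffun=> 0%N].

(** The argument of a policy in period [t] is the list
    [:: x(0); x(1); ...; x(t-1)] of all the load vectors up to the end of the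
    previous period, so a policy is non-anticipating, and it may depend on [t],
    which is the length of the list. *)
Definition policy (N : nat) : Type := seq (loads N) -> bool.

(** As [b.1 < b.2], a tie goes to the bin with the smallest index. *)
Definition least_loaded (N : nat) (x : loads N) (b : 'I_N * 'I_N) : 'I_N :=
  if (x b.1 <= x b.2)%N then b.1 else b.2.

Definition chosen_bin (N : nat) (x : loads N) (d : draw N) (w : bool) : 'I_N :=
  if flexible d && w then least_loaded x (flex_pair d) else preferred d.

Definition add_ball (N : nat) (x : loads N) (i : 'I_N) : loads N :=
  [ffun j => (x j + (j == i))%N].

Definition record_period (N : nat) (pi : policy N) (h : seq (loads N))
    (d : draw N) : seq (loads N) :=
  let x := last (no_balls N) h in
  rcons h (add_ball x (chosen_bin x d (pi h))).

(** [:: x(0); ...; x(t)] when [s] lists the draws of the periods 1, ..., t. *)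
Definition history (N : nat) (pi : policy N) (s : seq (draw N)) :
    seq (loads N) :=
  foldl (record_period pi) [:: no_balls N] s.

(** Loads at the end of the last period of [s]. *)
Definition final_loads (N : nat) (pi : policy N) (s : seq (draw N)) : loads N :=
  last (no_balls N) (history pi s).

Definition gap (R : realType) (N : nat) (pi : policy N) (s : seq (draw N)) : R :=
  (\max_(i < N) final_loads pi s i)%:R - (size s)%:R / N%:R.

(** Number of flex throws; the index [t : 'I_T] stands for period [t.+1], whose
    decision is based on the first [t] draws. *)
Definition flex_throws (N : nat) (pi : policy N) (T : nat)
    (s : T.-tuple (draw N)) : nat :=
  (\sum_(t < T) (flexible (tnth s t) && pi (history pi (take t s))))%N.

Definition expected_gap (R : realType) (N : nat) (q : R) (pi : policy N)
    (T : nat) : R :=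
  expect q (fun s : T.-tuple (draw N) => gap R pi s).

Definition expected_flex_throws (R : realType) (N : nat) (q : R)
    (pi : policy N) (T : nat) : R :=
  expect q (fun s : T.-tuple (draw N) => (flex_throws pi s)%:R).

(* Main.v *)
Require Import Defs.
From HB Require Import structures.
From mathcomp Require Import all_boot all_order all_algebra.
From mathcomp Require Import all_classical all_reals all_analysis.
From mathcomp Require Import zify ring lra.

Set Implicit Arguments.
Unset Strict Implicit.
Unset Printing Implicit Defensive.

Import Order.TTheory GRing.Theory Num.Theory.
Import numFieldNormedType.Exports.

Local Open Scope classical_set_scope.
Local Open Scope ring_scope.

(** Compare the policy with the process that puts every ball in its preferred
    bin, run on the same draws.  Let S be the number of balls preferring a fixed
    bin minus T/N.  Each flex throw takes at most one of them away from the bin,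
    so Gap + M >= S, and Gap >= 0; hence Gap + M >= max(S, 0).  The positive part
    of x dominates x/2 + x^2/(2a) - x^4/(8a^3) for a > 0.  As E[S] = 0,
    E[S^2] = v T and E[S^4] <= 3 v T^2 with v > 0, the choice a = sqrt T gives
    E[Gap] + E[M] >= v sqrt T / 8. *)

(** * The law of a single draw *)

Lemma card_flexset_gt0 (N : nat) : (2 <= N)%N -> (0 < #|flexset N|)%N.
Proof.
case: N => [|[|n]] // _; apply/card_gt0P.
by exists (exist _ (ord0, ord_max) isT : flexset n.+2).
Qed.

Lemma draw_prob_ge0 (R : realType) (N : nat) (q : R) (d : draw N) :
  0 < q -> q <= 1 -> 0 <= draw_prob q d.
Proof.
move=> q0 q1; rewrite /draw_prob !mulr_ge0 ?invr_ge0 ?ler0n //.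
by case: ifP => _; [exact: ltW | rewrite subr_ge0].
Qed.

(** The preferred bin has a uniform marginal: the weights [q] and [1 - q] add up to one, and the
    uniform weights of the flex sets cancel their number, which is nonzero since [N >= 2]. *)
Lemma sum_draw_prob_preferred (R : realType) (N : nat) (q : R)
    (f : 'I_N -> R) : (2 <= N)%N ->
  \sum_(d : draw N) draw_prob q d * f (preferred d) =
  N%:R^-1 * \sum_i f i.
Proof.
move=> N2; have c0 : #|flexset N|%:R != 0 :> R.
  by rewrite pnatr_eq0 -lt0n card_flexset_gt0.
rewrite -(pair_bigA _ (fun a b => draw_prob q (a, b) * f (preferred (a, b)))) /=.
rewrite -(pair_bigA _ (fun a b => \sum_(c : flexset N)
  draw_prob q ((a, b), c) * f (preferred ((a, b), c)))) /= mulr_sumr.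
apply: eq_bigr => i _; rewrite /draw_prob /preferred /flexible big_bool /=.
rewrite !sumr_const -!(mulr_natr (_ * f i)).
by move: c0; rewrite /flexset; move: _%:R N%:R^-1 (f i) => c n y c0; field.
Qed.

Lemma sum_draw_prob (R : realType) (N : nat) (q : R) : (2 <= N)%N ->
  \sum_(d : draw N) draw_prob q d = 1.
Proof.
move=> N2; have := sum_draw_prob_preferred q (fun=> 1) N2.
under eq_bigr do rewrite mulr1.
move=> ->; rewrite sumr_const card_ord mulVf // pnatr_eq0.
by case: N N2.
Qed.

(** * Expectations over independent draws, and moments of sums *)

Lemma expectD (R : realType) (N : nat) (q : R) (T : nat)
    (X Y : T.-tuple (draw N) -> R) :
  expect q (fun s => X s + Y s) = expect q X + expect q Y.
Proof. by rewrite -big_split; apply: eq_bigr => s _; rewrite mulrDr. Qed.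

Lemma expectZ (R : realType) (N : nat) (q : R) (T : nat) (c : R)
    (X : T.-tuple (draw N) -> R) :
  expect q (fun s => c * X s) = c * expect q X.
Proof. by rewrite mulr_sumr; apply: eq_bigr => s _; rewrite mulrCA. Qed.

Lemma ler_expect (R : realType) (N : nat) (q : R) (T : nat)
    (X Y : T.-tuple (draw N) -> R) : 0 < q -> q <= 1 ->
  (forall s, X s <= Y s) -> expect q X <= expect q Y.
Proof.
move=> q0 q1 XY; apply: ler_sum => s _; apply: ler_wpM2l => //.
by apply: prodr_ge0 => t _; exact: draw_prob_ge0.
Qed.

Lemma eq_expect (R : realType) (N : nat) (q : R) (T : nat)
    (X Y : T.-tuple (draw N) -> R) : X =1 Y -> expect q X = expect q Y.
Proof. by move=> XY; apply: eq_bigr => s _; rewrite XY. Qed.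

Lemma expect_nil (R : realType) (N : nat) (q : R) (X : 0.-tuple (draw N) -> R) :
  expect q X = X [tuple].
Proof.
rewrite /expect (big_pred1 [tuple]) => [|s]; first by rewrite big_ord0 mul1r.
by rewrite /= [s]tuple0; apply/esym/eqP/val_inj.
Qed.

(** Independence enters here: the product weight splits off the first draw. The moment computations
    are inductions on [T] through this identity. *)
Lemma expect_cons (R : realType) (N : nat) (q : R) (T : nat)
    (X : T.+1.-tuple (draw N) -> R) :
  expect q X =
  \sum_d draw_prob q d * expect q (fun s : T.-tuple _ => X [tuple of d :: s]).
Proof.
under eq_bigr do rewrite mulr_sumr.
rewrite pair_bigA /= /expect.
rewrite (reindex (fun p : draw N * T.-tuple (draw N) => [tuple of p.1 :: p.2])).
  apply: eq_bigr => -[d s] _ /=; rewrite big_ord_recl mulrA; congr (_ * _ * _).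
  by apply: eq_bigr => t _; rewrite tnthS.
exists (fun s => (thead s, [tuple of behead s])) => [[d s] _|s _] /=.
  by congr pair; exact: val_inj.
by rewrite -tuple_eta.
Qed.

Lemma expect_cst (R : realType) (N : nat) (q : R) (T : nat) (c : R) :
  (2 <= N)%N -> expect q (fun _ : T.-tuple (draw N) => c) = c.
Proof.
move=> N2; elim: T => [|T IH]; first by rewrite expect_nil.
rewrite expect_cons; under eq_bigr do rewrite IH.
by rewrite -mulr_suml sum_draw_prob // mul1r.
Qed.

Lemma expect_sum_centred (R : realType) (N : nat) (q : R) (f : draw N -> R)
    (T : nat) : (2 <= N)%N -> \sum_d draw_prob q d * f d = 0 ->
  expect q (fun s : T.-tuple (draw N) => \sum_(d <- s) f d) = 0.
Proof.
move=> N2 f0; elim: T => [|T IH]; first by rewrite expect_nil big_nil.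
rewrite expect_cons -[RHS]f0; apply: eq_bigr => d _; congr (_ * _).
under eq_expect do rewrite big_cons.
by rewrite expectD expect_cst // IH addr0.
Qed.

(** Splitting off the first draw, the cross term vanishes because the remaining sum is centred, so
    each draw contributes one variance. *)
Lemma expect_sum_sqr (R : realType) (N : nat) (q : R) (f : draw N -> R)
    (T : nat) : (2 <= N)%N -> \sum_d draw_prob q d * f d = 0 ->
  expect q (fun s : T.-tuple (draw N) => (\sum_(d <- s) f d) ^+ 2) =
  T%:R * \sum_d draw_prob q d * f d ^+ 2.
Proof.
move=> N2 f0; elim: T => [|T IH].
  by rewrite expect_nil big_nil expr0n mul0r.
set v := \sum_d _ in IH *.
rewrite expect_cons (eq_bigr (fun d =>
    draw_prob q d * f d ^+ 2 + draw_prob q d * (T%:R * v))) => [|d _].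
  by rewrite big_split -mulr_suml sum_draw_prob //= -/v -natr1; ring.
rewrite -mulrDr; congr (_ * _).
rewrite (@eq_expect _ _ _ _ _ (fun s : T.-tuple (draw N) =>
    f d ^+ 2 + (f d *+ 2 * \sum_(d <- s) f d + (\sum_(d <- s) f d) ^+ 2))).
  by rewrite !expectD expectZ expect_cst // expect_sum_centred // IH; ring.
by move=> s; rewrite big_cons; ring.
Qed.

(** The bound is kept linear in the variance [v], so that [v] factors out when it is set against the
    second moment [T * v]. *)
Lemma expect_sum_pow4_le (R : realType) (N : nat) (q : R) (f : draw N -> R)
    (T : nat) : (2 <= N)%N -> 0 < q -> q <= 1 -> (forall d, `|f d| <= 1) ->
  \sum_d draw_prob q d * f d = 0 ->
  expect q (fun s : T.-tuple (draw N) => (\sum_(d <- s) f d) ^+ 4) <=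
  3 * T%:R ^+ 2 * \sum_d draw_prob q d * f d ^+ 2.
Proof.
move=> N2 q0 q1 f1 f0.
set v := \sum_d _ * _ ^+ 2.
have f2 d : f d ^+ 2 <= 1 by rewrite -real_normK ?num_real // expr_le1.
have v0 : 0 <= v.
  by apply: sumr_ge0 => d _; rewrite mulr_ge0 ?sqr_ge0 ?draw_prob_ge0.
have v1 : v <= 1.
  rewrite -(sum_draw_prob q N2); apply: ler_sum => d _.
  by rewrite ler_piMr ?draw_prob_ge0.
have m4 : \sum_d draw_prob q d * f d ^+ 4 <= v.
  apply: ler_sum => d _; apply: ler_wpM2l; first exact: draw_prob_ge0.
  by rewrite (exprM _ 2 2) [leLHS]expr2 ler_piMl ?sqr_ge0.
elim: T => [|T IH].
  by rewrite expect_nil big_nil expr0n /= expr0n /= mulr0 mul0r.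
set m := expect _ _ in IH.
(* The third moment need not be evaluated: its coefficient is the mean of [f], which is zero. *)
pose c := expect q (fun s : T.-tuple (draw N) => (\sum_(d <- s) f d) ^+ 3).
rewrite expect_cons (eq_bigr (fun d =>
    draw_prob q d * f d ^+ 4 + draw_prob q d * f d ^+ 2 * (6 * (T%:R * v))
    + (draw_prob q d * f d * (4 * c) + draw_prob q d * m))) => [|d _].
  rewrite !big_split -3!mulr_suml sum_draw_prob // f0 /= -/v.
  (* One more draw adds at most [v + 6 T v^2], hence at most [(6 T + 1) v] as [v <= 1], while the
     bound grows by [3 v ((T + 1)^2 - T^2) = (6 T + 3) v]. *)
  have : T%:R * (v * v) <= T%:R * v by rewrite ler_wpM2l ?ler_piMl.
  rewrite -natr1; lra.
have sE (s : T.-tuple (draw N)) : (\sum_(d <- [tuple of d :: s]) f d) ^+ 4 =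
    f d ^+ 4 + (4 * f d ^+ 3 * (\sum_(d <- s) f d)
    + (6 * f d ^+ 2 * (\sum_(d <- s) f d) ^+ 2
    + (4 * f d * (\sum_(d <- s) f d) ^+ 3 + (\sum_(d <- s) f d) ^+ 4))).
  by rewrite big_cons; ring.
rewrite (eq_expect _ sE) !expectD !expectZ expect_cst // expect_sum_centred //.
by rewrite expect_sum_sqr // -/v -/m -/c; ring.
Qed.

(** * The centred indicator of preferring a fixed bin *)

Definition preference_excess (R : realType) (N : nat) (i : 'I_N) (d : draw N) :
  R := (preferred d == i)%:R - N%:R^-1.

Lemma preference_excess_mean (R : realType) (N : nat) (q : R) (i : 'I_N) :
  (2 <= N)%N -> \sum_d draw_prob q d * preference_excess R i d = 0.
Proof.
move=> N2; rewrite (sum_draw_prob_preferred q (fun j => (j == i)%:R - N%:R^-1)) //.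
rewrite sumrB sumr_const card_ord (bigD1 i) //= eqxx big1 => [|j /negbTE-> //].
by rewrite addr0 -(mulr_natr N%:R^-1) mulVf ?subrr ?mulr0 // pnatr_eq0; case: N i N2.
Qed.

Lemma preference_excess_norm (R : realType) (N : nat) (i : 'I_N) (d : draw N) :
  (2 <= N)%N -> `|preference_excess R i d| <= 1.
Proof.
move=> N2; have N1 : N%:R^-1 <= 1 :> R.
  by rewrite invf_le1 ?ler1n ?ltr0n; lia.
have : 0 <= N%:R^-1 :> R by rewrite invr_ge0.
by rewrite /preference_excess ler_norml; case: (_ == _) => /=; lra.
Qed.

(** Preferring [i] itself already contributes a positive multiple of [(1 - 1/N)^2], which is
    positive as [N >= 2]. *)
Lemma preference_excess_var_gt0 (R : realType) (N : nat) (q : R) (i : 'I_N) :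
  (2 <= N)%N -> 0 < \sum_d draw_prob q d * preference_excess R i d ^+ 2.
Proof.
move=> N2; rewrite (sum_draw_prob_preferred q
  (fun j => ((j == i)%:R - N%:R^-1) ^+ 2)) //.
rewrite mulr_gt0 ?invr_gt0 ?ltr0n; [|lia|] => //.
rewrite (bigD1 i) //= eqxx ltr_wpDr ?sumr_ge0 // => [j _|]; first exact: sqr_ge0.
have N1 : N%:R^-1 < 1 :> R by rewrite invf_lt1 ?ltr1n ?ltr0n; lia.
by rewrite exprn_gt0 // subr_gt0.
Qed.

(** * Pathwise comparison with the process without flexibility *)

Lemma history_rcons (N : nat) (pi : policy N) (s : seq (draw N)) (d : draw N) :
  history pi (rcons s d) = record_period pi (history pi s) d.
Proof. by rewrite /history -cats1 foldl_cat. Qed.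

Lemma final_loads_rcons (N : nat) (pi : policy N) (s : seq (draw N))
    (d : draw N) :
  final_loads pi (rcons s d) = add_ball (final_loads pi s)
    (chosen_bin (final_loads pi s) d (pi (history pi s))).
Proof. by rewrite /final_loads history_rcons last_rcons. Qed.

Lemma sum_final_loads (N : nat) (pi : policy N) (s : seq (draw N)) :
  (\sum_i final_loads pi s i = size s)%N.
Proof.
elim/last_ind: s => [|s d IH].
  by apply: big1 => i _; rewrite ffunE.
rewrite final_loads_rcons size_rcons -IH -addn1.
under eq_bigr do rewrite ffunE.
rewrite big_split /=; congr addn.
set c := chosen_bin _ _ _.
by rewrite (bigD1 c) //= eqxx big1 // => j /negbTE->.
Qed.

(** In a period without a flex throw, the count and the load of [i] change alike. In a flex throw
    the count grows by at most one, the load does not decrease, and the number of throws grows by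
    one. *)
Lemma count_preferred_le (N : nat) (pi : policy N) (T : nat)
    (s : T.-tuple (draw N)) (i : 'I_N) :
  (count (fun d => preferred d == i) s <= final_loads pi s i + flex_throws pi s)%N.
Proof.
(* The induction runs over prefixes of the fixed tuple [s], with the throws restricted to the first
   [n] periods. *)
suff H n : (n <= T)%N ->
    (count (fun d => preferred d == i) (take n s) <= final_loads pi (take n s) i
     + \sum_(t < T | t < n) (flexible (tnth s t) && pi (history pi (take t s))))%N.
  have := H T (leqnn T); rewrite take_oversize ?size_tuple // => /leq_trans; apply.
  by rewrite leq_add2l; apply: eq_leq; apply: eq_bigl => t; rewrite ltn_ord.
elim: n => [|n IH] nT; first by rewrite take0.
pose t := Ordinal nT.
rewrite (take_nth (tnth s t)) ?size_tuple // -[nth _ _ n]/(nth _ _ t) -tnth_nth.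
rewrite final_loads_rcons ffunE -cats1 count_cat /= addn0.
rewrite (bigD1 t) //= (eq_bigl (fun u : 'I_T => (u < n)%N)) => [|u]; last first.
  by rewrite -val_eqE /=; lia.
have {IH} := IH (ltnW nT); move: (\sum_(u < T | _) _)%N => m.
rewrite /chosen_bin; case: ifP => _ /=; last first.
  by rewrite add0n addnAC [i == _]eq_sym leq_add2r.
move: (count _ _) (final_loads _ _ _) => c l.
by case: (preferred _ == i); case: (i == _) => /=; lia.
Qed.

Lemma gap_ge_load (R : realType) (N : nat) (pi : policy N) (s : seq (draw N))
    (i : 'I_N) : (final_loads pi s i)%:R - (size s)%:R / N%:R <= gap R pi s.
Proof. by rewrite /gap lerD2r ler_nat leq_bigmax. Qed.

(** The loads add up to the number of balls, so their maximum is at least their average. *)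
Lemma gap_ge0 (R : realType) (N : nat) (pi : policy N) (s : seq (draw N)) :
  (0 < N)%N -> 0 <= gap R pi s.
Proof.
move=> N0; rewrite /gap subr_ge0 ler_pdivrMr ?ltr0n // -natrM ler_nat.
rewrite -(sum_final_loads pi s) -[X in (_ * X)%N]card_ord mulnC -sum_nat_const.
by apply: leq_sum => i _; exact: leq_bigmax.
Qed.

Lemma sum_preference_excess (R : realType) (N : nat) (i : 'I_N)
    (s : seq (draw N)) :
  \sum_(d <- s) preference_excess R i d =
  (count (fun d => preferred d == i) s)%:R - (size s)%:R / N%:R.
Proof.
rewrite sumrB big_const_seq count_predT iter_addr_0 -(mulr_natl N%:R^-1); congr (_ - _).
by rewrite -sum1_count natr_sum [RHS]big_mkcond; apply: eq_bigr => d _; case: (_ == _).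
Qed.

Lemma sum_preference_excess_le (R : realType) (N : nat) (pi : policy N)
    (T : nat) (s : T.-tuple (draw N)) (i : 'I_N) :
  \sum_(d <- s) preference_excess R i d <= gap R pi s + (flex_throws pi s)%:R.
Proof.
rewrite sum_preference_excess.
have := count_preferred_le pi s i; rewrite -(ler_nat R) natrD.
by have := gap_ge_load R pi s i; lra.
Qed.

(** * The quartic minorant and the lower bound *)

Lemma quartic_le_pos_part (R : realFieldType) (a x y : R) :
  0 < a -> 0 <= y -> x <= y ->
  2^-1 * x + ((2 * a)^-1 * x ^+ 2 + - (8 * a ^+ 3)^-1 * x ^+ 4) <= y.
Proof.
move=> a0 y0 xy; have [u xE] : exists u, x = u * a.
  by exists (x / a); rewrite divfK // gt_eqF.
have -> : 2^-1 * x + ((2 * a)^-1 * x ^+ 2 + - (8 * a ^+ 3)^-1 * x ^+ 4) =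
    a * (4 * u + 4 * u ^+ 2 - u ^+ 4) / 8.
  by rewrite xE; field; rewrite gt_eqF.
(* With [x = u * a], both signs of [u] reduce to this one inequality, taken at [w = u] against
   [x <= y] and at [w = - u] against [0 <= y]. *)
have quartic_ge0 w : 0 <= w -> 0 <= a * (4 * w - 4 * w ^+ 2 + w ^+ 4).
  move=> w0; have -> : 4 * w - 4 * w ^+ 2 + w ^+ 4 =
      w * (w * (w - 1) ^+ 2 + 2 * (w - 5 / 4) ^+ 2 + 7 / 8) by field.
  apply: mulr_ge0; first exact: ltW.
  have := mulr_ge0 w0 (sqr_ge0 (w - 1)); have := sqr_ge0 (w - 5 / 4).
  by move=> h1 h2; apply: mulr_ge0 => //; lra.
have [u0|u0] := leP 0 u.
  by apply: le_trans xy; have := quartic_ge0 u u0; rewrite xE; lra.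
apply: le_trans y0; have := quartic_ge0 (- u); rewrite oppr_ge0 ltW //.
by rewrite sqrrN (exprM _ 2 2) sqrrN -exprM => /(_ isT); lra.
Qed.

Lemma expected_gap_flex_throws_ge (R : realType) (N : nat) (q : R)
    (pi : policy N) (T : nat) (i : 'I_N) :
  (2 <= N)%N -> 0 < q -> q <= 1 -> (0 < T)%N ->
  8^-1 * (\sum_d draw_prob q d * preference_excess R i d ^+ 2) * Num.sqrt T%:R
  <= expected_gap q pi T + expected_flex_throws q pi T.
Proof.
move=> N2 q0 q1 T0; set f := preference_excess R i; set v := \sum_d _.
set a := Num.sqrt T%:R; have a0 : 0 < a by rewrite sqrtr_gt0 ltr0n.
have aT : T%:R = a ^+ 2 by rewrite sqr_sqrtr ?ler0n.
have f0 : \sum_d draw_prob q d * f d = 0 by exact: preference_excess_mean.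
rewrite /expected_gap /expected_flex_throws -expectD.
(* The quartic bound is used on each sample with [x] the excess of preferences for [i] and [y] the
   gap plus the number of flex throws. *)
have := @ler_expect R N q T _ _ q0 q1 (fun s => quartic_le_pos_part a0
  (addr_ge0 (gap_ge0 R pi s (ltnW N2)) (ler0n R (flex_throws pi s)))
  (sum_preference_excess_le R pi s i)).
apply: le_trans; rewrite !expectD !expectZ expect_sum_centred // expect_sum_sqr //.
have := expect_sum_pow4_le T N2 q0 q1 (fun d => preference_excess_norm R i d N2) f0.
rewrite -/v aT; set m := expect _ _ => mle.
(* With [T = a^2] the moments give [v a / 2 - 3 v a / 8 = v a / 8]. *)
have -> : 8^-1 * v * a = 2^-1 * 0 + ((2 * a)^-1 * (a ^+ 2 * v) +
    - (8 * a ^+ 3)^-1 * (3 * (a ^+ 2) ^+ 2 * v)).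
  by field; rewrite gt_eqF.
rewrite !lerD2l !mulNr lerN2 ler_wpM2l // invr_ge0.
by rewrite mulr_ge0 ?exprn_ge0 // ltW.
Qed.

Theorem proposition1 (R : realType) (N : nat) (q : R) (pi : nat -> policy N)
    (hN : (2 <= N)%N) (hq0 : 0 < q) (hq1 : q <= 1)
    (hgap : (fun T : nat => expected_gap q (pi T) T : R^o)
              =O_\oo (fun T : nat => 1 : R^o)) :
  (fun T : nat => expected_flex_throws q (pi T) T : R^o)
    =Omega_\oo (fun T : nat => Num.sqrt T%:R : R^o).
Proof.
(* Any bin would do; this is the one of index 0. *)
pose i : 'I_N := Ordinal (ltnW hN).
have v0 := preference_excess_var_gt0 q i hN.
set v := \sum_d _ in v0.
(* The constant [v / 16] is half of the [v / 8] available; the other half absorbs the bound [C] on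
   the expected gap. *)
rewrite eqOmegaE qualifE; apply/asboolP; exists (16^-1 * v).
  by rewrite mulr_gt0 // invr_gt0.
have /eqO_exP[C C0 hC] := hgap.
near=> T.
have T0 : (0 < T)%N by near: T; exact: nbhs_infty_gt.
have gC : `|expected_gap q (pi T) T| <= C * `|1 : R| by near: T; exact: hC.
(* This says [C <= (v / 16) * sqrt T], and holds once [T] is at least the square of [16 * C / v]. *)
have aC : 16 * C / v <= Num.sqrt T%:R.
  rewrite -(@ger0_norm _ (16 * C / v)) -?sqrtr_sqr.
    by rewrite ler_sqrt //; near: T; exact: nbhs_infty_ger.
  by rewrite divr_ge0 ?mulr_ge0 // ltW.
have := expected_gap_flex_throws_ge (pi T) i hN hq0 hq1 T0; rewrite -/v.
move: aC gC; rewrite ler_pdivrMr // normr1 mulr1 => aC gC hle.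
rewrite [X in _ * X]ger0_norm ?sqrtr_ge0 //; apply: le_trans (ler_norm _).
have := ler_norm (expected_gap q (pi T) T); lra.
Unshelve. all: by end_near. Qed.
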